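(* Exactly $\gcd(3,q-1)$ of the $\mathbb{F}_q$-planes in $\mathrm{orb}(\mathsf S_T)$ are fixed setwise by $\phi$, namely the sets $\pi_\lambda=\{(x,x^q,\lambda x^{q^2}):x\in\mathbb{F}_{q^3}^*\}$ with $\lambda\in\mathbb{F}_q$, $\lambda^3=1$. Further $\pi_1=\mathcal P_{2,q}$, and if $\gcd(3,q-1)=3$ then the other two $\mathbb{F}_q$-planes fixed setwise by $\phi$ consist of only Type III points and only Type III lines.
   Context: Let $q$ be a prime power, $\mathbb{F}_{q^3}^*=\mathbb{F}_{q^3}\setminus\{0\}$. Points of $\mathrm{PG}(2,q^3)$ have homogeneous coordinates $(x,y,z)$ and lines $[a,b,c]$. An $\mathbb{F}_q$-plane is a subplane of order $q$; its lines are those meeting it in $q+1$ points. Let $\phi$ be the collineation $(x,y,z)\mapsto(z^q,x^q,y^q)$ (on lines $[d,e,f]\mapsto[f^q,d^q,e^q]$), whose fixed points form $\mathcal P_{2,q}=\{(x,x^q,x^{q^2}):x\in\mathbb{F}_{q^3}^*\}$. A point has Type I, II, III according as its $\phi$-orbit is one point, three collinear points, three non-collinear points; a line has Type I, II, III according as its $\phi$-orbit is one line, three concurrent lines, three non-concurrent lines. Let $\psi_t:(x,y,z)\mapsto(tx,t^qy,t^{q^2}z)$ for $t\in\mathbb{F}_{q^3}^*$, $\mathsf S_T=\{\psi_t\}$, and $\mathrm{orb}(\mathsf S_T)$ the set of point orbits of $\mathsf S_T$. *)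

(* Defs.v *)
(* Model of PG(2,q^3) over a finite field F with #|F| = q^3. *)
From HB Require Import structures.
From mathcomp Require Import all_boot all_order all_algebra all_field.
Unset Printing Implicit Defensive.
Import GRing.Theory.
Local Open Scope ring_scope.

Section PG2.
Variables (F : finFieldType) (q : nat).

Definition vec : finType := (F * F * F)%type.
Definition vzero : vec := (0, 0, 0).
Definition scalev (k : F) (v : vec) : vec := (k * v.1.1, k * v.1.2, k * v.2).

Definition pt (v : vec) : {set vec} := (scalev^~ v) @: [set k : F | k != 0].

(* points of PG(2,F); lines are represented in the same way (dual coordinates) *)
Definition points : {set {set vec}} :=
  [set P : {set vec} | [exists v : vec, (v != vzero) && (P == pt v)]].

Definition dotv (v w : vec) : F := v.1.1 * w.1.1 + v.1.2 * w.1.2 + v.2 * w.2.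

Definition incid (P L : {set vec}) : bool :=
  [exists v in P, exists w in L, dotv v w == 0].

Definition pts_on (L : {set vec}) : {set {set vec}} := [set P in points | incid P L].

Definition collinear (P1 P2 P3 : {set vec}) : bool :=
  [exists L in points, [&& incid P1 L, incid P2 L & incid P3 L]].

Definition concurrent (L1 L2 L3 : {set vec}) : bool :=
  [exists P in points, [&& incid P L1, incid P L2 & incid P L3]].

Definition secant (S : {set {set vec}}) (L : {set vec}) : bool :=
  (2 <= #|S :&: pts_on L|)%N.

(* S is a subplane of order q (an F_q-plane) of PG(2,F): with the lines meeting
   it in >= 2 points it is a projective plane of order q. *)
Definition Fq_plane (S : {set {set vec}}) : bool :=
  [&& S \subset points,
      [forall L in points, secant S L ==> (#|S :&: pts_on L| == q + 1)%N],
      [forall L in points, forall M in points,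
         [&& secant S L, secant S M & L != M] ==>
         [exists P in S, incid P L && incid P M]] &
      [exists P1 in S, exists P2 in S, exists P3 in S, exists P4 in S,
         [&& ~~ collinear P1 P2 P3, ~~ collinear P1 P2 P4,
             ~~ collinear P1 P3 P4 & ~~ collinear P2 P3 P4]]].

(* the collineation phi : (x,y,z) |-> (z^q, x^q, y^q); same formula on lines *)
Definition phiv (v : vec) : vec := (v.2 ^+ q, v.1.1 ^+ q, v.1.2 ^+ q).
Definition phiP (P : {set vec}) : {set vec} := phiv @: P.
Definition phiS (S : {set {set vec}}) : {set {set vec}} := phiP @: S.

Definition P2q : {set {set vec}} := [set P in points | phiP P == P].

Definition typeIII_pt (P : {set vec}) : bool :=
  ~~ collinear P (phiP P) (phiP (phiP P)).
Definition typeIII_line (L : {set vec}) : bool :=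
  ~~ concurrent L (phiP L) (phiP (phiP L)).

Definition psiv (t : F) (v : vec) : vec :=
  (t * v.1.1, t ^+ q * v.1.2, t ^+ (q ^ 2) * v.2).
Definition psiP (t : F) (P : {set vec}) : {set vec} := psiv t @: P.

Definition ST_orbit (P : {set vec}) : {set {set vec}} :=
  (psiP^~ P) @: [set t : F | t != 0].
Definition orb_ST : {set {set {set vec}}} := ST_orbit @: points.

Definition pi_lam (lam : F) : {set {set vec}} :=
  (fun x : F => pt (x, x ^+ q, lam * x ^+ (q ^ 2))) @: [set x : F | x != 0].

Definition fixed_planes : {set {set {set vec}}} :=
  [set X in orb_ST | Fq_plane X && (phiS X == X)].

End PG2.

(* Main.v *)
(** The points [(x, x^q, lam x^(q^2))] of [pi_lam] are parametrised by [x] modulo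
    scalars in [F_q]; the cross product of two of them is, up to a factor, the
    dual vector [(a, a^q, lam^-1 a^(q^2))], so the secants of [pi_lam] form the
    same figure with [lam^-1], which gives the axioms of a subplane.  An orbit
    of [S_T] off the coordinate triangle is classified by [N(y/x)] and by
    [mu = z x^q / y^(q+1)]; invariance under [phi] forces [N(y/x) = 1],
    [mu^q = mu] and [mu^3 = 1], and Hilbert 90 then identifies the orbit with
    [pi_mu].  On [pi_lam] the three conjugates of a point under [phi] give a
    circulant determinant [3 (1 - lam)], nonzero for [lam <> 1]. *)

Require Import Defs.
From HB Require Import structures.
From mathcomp Require Import all_boot all_order all_algebra all_field cyclic ring zify.
Import GRing.Theory.
Local Open Scope ring_scope.

(** * Roots of unity in a finite field *)

Lemma expf_card_pred (F : finFieldType) (x : F) : x != 0 -> x ^+ #|F|.-1 = 1.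
Proof.
move=> x_neq0; apply: (mulfI x_neq0); rewrite mulr1 -exprS prednK ?expf_card //.
exact: ltnW (finNzRing_gt1 F).
Qed.

Lemma cube_root_neq0 (R : nzRingType) (x : R) : x ^+ 3 = 1 -> x != 0.
Proof. by apply: contra_eq_neq => ->; rewrite expr0n eq_sym oner_eq0. Qed.

Lemma ex_primitive_root (F : finFieldType) :
  exists g : F, (#|F|.-1).-primitive_root g.
Proof.
have F_gt1 := finNzRing_gt1 F.
have /hasP[g _ prim_g] : has (#|F|.-1).-primitive_root (enum [pred x : F | x != 0]).
  apply: has_prim_root.
  - by case: #|F| F_gt1 => [|[|]].
  - apply/allP => x; rewrite mem_enum inE => x_neq0.
    by rewrite unity_rootE expf_card_pred.
  - exact: enum_uniq.
  - by rewrite -cardE (cardC1 (0 : F)).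
by exists g.
Qed.

(** A suitable power of a generator of the multiplicative group is a primitive [d]-th root of unity,
    and its first [d] powers list the solutions without repetition. *)
Lemma card_unity_roots (F : finFieldType) (d : nat) :
  (d %| #|F|.-1)%N -> #|[set c : F | c ^+ d == 1]| = d.
Proof.
move=> d_dvd; have [g prim_g] := ex_primitive_root F.
have prim_z := dvdn_prim_root prim_g d_dvd; set z := g ^+ _ in prim_z.
have inj_z : injective (fun i : 'I_d => z ^+ i).
  move=> i j /eqP; rewrite (eq_prim_root_expr prim_z) !modn_small //.
  by move/eqP/val_inj.
rewrite -[RHS]card_ord -(card_imset _ inj_z).
apply: eq_card => c; rewrite inE.
apply/eqP/imsetP => [/(prim_rootP prim_z)[i ->] | [i _ ->]].
  by exists i.
by rewrite exprAC (prim_expr_order prim_z) expr1n.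
Qed.

(** * Homogeneous coordinates and incidence *)

Section ProjectivePoints.
Variable F : finFieldType.
Implicit Types (u v w : vec F) (k : F).

Lemma ptP u v : reflect (exists2 k, k != 0 & u = scalev F k v) (u \in pt F v).
Proof.
by apply: (iffP imsetP) => -[k]; rewrite ?inE => k0 ->; exists k; rewrite ?inE.
Qed.

Lemma scalevA k l v : scalev F k (scalev F l v) = scalev F (k * l) v.
Proof. by rewrite /scalev /= !mulrA. Qed.

Lemma scale1v v : scalev F 1 v = v.
Proof. by case: v => [[x y] z]; rewrite /scalev /= !mul1r. Qed.

Lemma pt_scale k v : k != 0 -> pt F (scalev F k v) = pt F v.
Proof.
move=> k0; apply/setP => u; apply/ptP/ptP => -[l l0 ->].
  by exists (l * k); rewrite ?mulf_neq0 // scalevA.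
by exists (l / k); rewrite ?mulf_neq0 ?invr_eq0 // scalevA divfK.
Qed.

Lemma eq_pt u v : pt F u = pt F v -> exists2 k, k != 0 & u = scalev F k v.
Proof.
by move=> uv; apply/ptP; rewrite -uv; apply/ptP; exists 1; rewrite ?oner_eq0 ?scale1v.
Qed.

Lemma pointsP (P : {set vec F}) :
  reflect (exists2 v, v != vzero F & P = pt F v) (P \in points F).
Proof.
rewrite inE; apply: (iffP existsP) => [[v /andP[v0 /eqP->]]|[v v0 ->]]; exists v => //.
by rewrite v0 eqxx.
Qed.

Lemma pt_points v : v != vzero F -> pt F v \in points F.
Proof. by move=> v0; apply/pointsP; exists v. Qed.

Lemma dotvZl k v w : dotv F (scalev F k v) w = k * dotv F v w.
Proof. by rewrite /dotv /=; ring. Qed.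

Lemma dotvC v w : dotv F v w = dotv F w v.
Proof. by rewrite /dotv; ring. Qed.

Lemma incid_pt v w : incid F (pt F v) (pt F w) = (dotv F v w == 0).
Proof.
have mem_pt u : u \in pt F u by apply/ptP; exists 1; rewrite ?oner_eq0 ?scale1v.
apply/existsP/idP => [[_ /andP[/ptP[k k0 ->]]]|vw0].
  case/existsP=> _ /andP[/ptP[l l0 ->]].
  by rewrite dotvZl dotvC dotvZl !mulf_eq0 (negPf k0) (negPf l0) dotvC.
by exists v; rewrite mem_pt; apply/existsP; exists w; rewrite mem_pt.
Qed.

Lemma collinearP u v w :
  reflect (exists2 l, l != vzero F & [/\ dotv F u l = 0, dotv F v l = 0 & dotv F w l = 0])
    (collinear F (pt F u) (pt F v) (pt F w)).
Proof.
apply: (iffP existsP) => [[_ /andP[/pointsP[l l0 ->]]]|[l l0 [ul vl wl]]].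
  by rewrite !incid_pt => /and3P[/eqP ul /eqP vl /eqP wl]; exists l.
by exists (pt F l); rewrite pt_points // !incid_pt ul vl wl eqxx.
Qed.

(** Self-duality of the coordinates: [dotv] is symmetric. It transfers Type III statements from
    points to lines. *)
Lemma concurrent_collinear u v w :
  concurrent F (pt F u) (pt F v) (pt F w) = collinear F (pt F u) (pt F v) (pt F w).
Proof.
rewrite /concurrent /collinear; apply: eq_existsb => P.
case: (boolP (P \in _)) => //= /pointsP[l _ ->].
by rewrite !incid_pt ![dotv F l _]dotvC.
Qed.

Lemma vec_neq0 x y z : x != 0 -> ((x, y, z) : vec F) != vzero F.
Proof. by apply: contraNneq => -[->]. Qed.

(** Three points of the quadrangle are already non-collinear. Applied to the coordinate lines, this
    keeps an orbit that is a plane off the coordinate triangle. *)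
Lemma plane_not_on_line (S : {set {set vec F}}) q l : Fq_plane F q S -> l != vzero F ->
  exists2 P, P \in S & ~~ incid F P (pt F l).
Proof.
case/and4P=> _ _ _ /existsP[P /andP[PS /existsP[Q /andP[QS /existsP[R /andP[RS]]]]]].
case/existsP=> _ /and5P[_ ncol _ _ _] l0.
have [Pl|nPl] := boolP (incid F P (pt F l)); last by exists P.
have [Ql|nQl] := boolP (incid F Q (pt F l)); last by exists Q.
have [Rl|nRl] := boolP (incid F R (pt F l)); last by exists R.
by case/existsP: ncol; exists (pt F l); rewrite pt_points // Pl Ql Rl.
Qed.

End ProjectivePoints.

(** * The Frobenius map of the cubic extension, and Hilbert 90 *)

Section CubicFrobenius.
Variables (F : finFieldType) (q : nat).
Hypothesis q_pow : exists2 p : nat, prime p & exists k : nat, q = (p ^ k.+1)%N.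
Hypothesis cardF : #|F| = (q ^ 3)%N.

Lemma q_gt1 : (1 < q)%N.
Proof.
have [p p_pr [k ->]] := q_pow.
by rewrite -(exp1n k.+1) ltn_exp2r // prime_gt1.
Qed.

Lemma pchar_q : [pchar F].-nat q.
Proof.
have [p p_pr [k qE]] := q_pow.
have cardFp : #|F| = (p ^ (k.+1 * 3))%N by rewrite cardF qE expnM.
have pF := card_finPcharP cardFp p_pr.
by rewrite qE pnatX (eq_pnat _ (pcharf_eq pF)) pnat_id //.
Qed.

Lemma frobD (x y : F) : (x + y) ^+ q = x ^+ q + y ^+ q.
Proof. exact: exprDn_pchar pchar_q. Qed.

Lemma frobN (x : F) : (- x) ^+ q = - x ^+ q.
Proof. exact: exprNn_pchar pchar_q. Qed.

Lemma frob3 (x : F) : ((x ^+ q) ^+ q) ^+ q = x.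
Proof. by rewrite -!exprM -{2}(expf_card x) cardF !expnS expn0 muln1 mulnA. Qed.

Lemma expq2 (x : F) : x ^+ (q ^ 2)%N = (x ^+ q) ^+ q.
Proof. by rewrite -exprM mulnn. Qed.

Lemma frob_inj : injective (fun x : F => x ^+ q).
Proof. by move=> x y /= xy; rewrite -(frob3 x) xy frob3. Qed.

Lemma frob_eq0 (x : F) : (x ^+ q == 0) = (x == 0).
Proof. by rewrite expf_eq0 (ltnW q_gt1). Qed.

(** Rewriting with this bundle pushes [q]-th powers down to the variables, writes [x ^+ (q ^ 2)] as
    an iterated power and cancels threefold iterates, so that [ring] and [field] can conclude. *)
Definition frobE := (frobD, frobN, @exprMn F, frob3, @expr1n F, expq2).

Lemma fixed_frobE (c : F) : (c ^+ q == c) = (c == 0) || (c ^+ q.-1 == 1).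
Proof.
have q_gt0 := ltnW q_gt1.
have [->|c_neq0] := eqVneq c 0; first by rewrite expr0n gtn_eqF ?eqxx.
by rewrite -{1}(prednK q_gt0) exprS -[X in _ == X]mulr1 (inj_eq (mulfI c_neq0)).
Qed.

Lemma cardF_pred : (#|F|.-1 = (q ^ 2 + q + 1) * q.-1)%N.
Proof.
rewrite cardF -(prednK (ltnW q_gt1)) /=; move: q.-1 => n.
by rewrite !expnS expn0; lia.
Qed.

(** The nonzero fixed elements are the roots of unity of order dividing [q - 1], and [q - 1] divides
    [q ^ 3 - 1]; zero is the remaining one. *)
Lemma card_fixed_frob : #|[set c : F | c ^+ q == c]| = q.
Proof.
have dvdq : (q.-1 %| #|F|.-1)%N by rewrite cardF_pred dvdn_mull.
have q_gt0 := ltnW q_gt1.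
rewrite (cardsD1 0) inE frob_eq0 eqxx -[RHS](prednK q_gt0) add1n; congr _.+1.
rewrite -[RHS](card_unity_roots _ _ dvdq); apply: eq_card => c.
rewrite !inE fixed_frobE; have [->|//] := eqVneq c 0.
by rewrite expr0n gtn_eqF ?(eq_sym _ 1) ?oner_eq0 // -ltnS (prednK q_gt0) q_gt1.
Qed.

Definition frob_norm (x : F) : F := x * x ^+ q * (x ^+ q) ^+ q.

(** Write [u = g ^+ i] with [g] a generator. Norm 1 means that [q ^ 3 - 1] divides
    [i * (q ^ 2 + q + 1)], hence [q - 1] divides [i], and [t = g ^+ (i / (q - 1))] works. *)
Lemma hilbert90 (u : F) : frob_norm u = 1 ->
  exists2 t : F, t != 0 & u * t = t ^+ q.
Proof.
have q_gt0 := ltnW q_gt1.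
rewrite /frob_norm => Nu; have [g prim_g] := ex_primitive_root F.
have u_neq0 : u != 0.
  by apply: contra_eq_neq Nu => ->; rewrite !mul0r eq_sym oner_eq0.
have [i uE] : exists i : nat, u = g ^+ i.
  by have [i ->] := prim_rootP prim_g (expf_card_pred _ _ u_neq0); exists i.
have : g ^+ (i * (q ^ 2 + q + 1)) = 1.
  rewrite exprM -uE !exprD expr1 expq2 -Nu; ring.
move/eqP; rewrite -(prim_order_dvd prim_g) cardF_pred mulnC dvdn_pmul2r ?addn1 //.
case/dvdnP=> j iE; exists (g ^+ j).
  apply/expf_neq0; apply: contra_eq_neq (prim_expr_order prim_g) => ->.
  by rewrite expr0n gtn_eqF ?(prim_order_gt0 prim_g) // eq_sym oner_eq0.
by rewrite uE iE -exprM -exprD; congr (g ^+ _); rewrite -{2}(prednK q_gt0) mulnS addnC.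
Qed.

(* [wedge x y] and its two conjugates are the coordinates of the cross product
   of [(x, x^q, x^(q^2))] and [(y, y^q, y^(q^2))]. *)
Definition wedge (x y : F) : F := x * y ^+ q - x ^+ q * y.

Lemma wedge_eq0 (x y : F) : y != 0 -> wedge x y = 0 ->
  exists2 c : F, c ^+ q = c & x = c * y.
Proof.
move=> y_neq0 /subr0_eq xy; exists (x / y); last by rewrite divfK.
by rewrite exprMn exprVn; apply/eqP; rewrite eqr_div ?frob_eq0 // -xy.
Qed.

Lemma wedge_frob (x y : F) :
  ((wedge x y) ^+ q = x ^+ q * (y ^+ q) ^+ q - (x ^+ q) ^+ q * y ^+ q).
Proof. by rewrite !frobE. Qed.

Lemma wedge_frob2 (x y : F) :
  ((wedge x y) ^+ q) ^+ q = (x ^+ q) ^+ q * y - x * (y ^+ q) ^+ q.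
Proof. by rewrite !frobE. Qed.

(** * Existence of a nonzero Moore determinant *)

Lemma ex_not_fixed : exists x : F, x ^+ q != x.
Proof.
apply/existsP; apply: contraT; rewrite negb_exists => /forallP all_fixed.
have := card_fixed_frob; rewrite (eq_card (B := F)) => [|x]; last first.
  by rewrite !inE -[LHS]negbK all_fixed.
rewrite cardF -[RHS]expn1 => /eqP; rewrite eqn_exp2l //; exact: q_gt1.
Qed.

(** The trace is a polynomial of degree [q ^ 2], too small to vanish at all [q ^ 3] elements. *)
Lemma ex_trace_neq0 : exists x : F, x + x ^+ q + (x ^+ q) ^+ q != 0.
Proof.
apply/existsP; apply: contraT; rewrite negb_exists => /forallP tr0.
pose p : {poly F} := 'X^(q ^ 2) + ('X + 'X^q).
have q_lt : (q < q ^ 2)%N by rewrite -{1}[q]expn1 ltn_exp2l ?q_gt1.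
have size_p : size p = (q ^ 2).+1.
  rewrite size_polyDl size_polyXn // ltnS.
  rewrite (leq_trans (size_polyD _ _)) // size_polyX size_polyXn geq_max q_lt.
  by rewrite (leq_trans q_gt1 (ltnW q_lt)).
have p_neq0 : p != 0 by rewrite -size_poly_eq0 size_p.
suff /(max_poly_roots p_neq0)/(_ (enum_uniq F)) : all (root p) (enum F).
  by rewrite -cardE cardF size_p ltnS leq_exp2l ?q_gt1.
apply/allP => x _; rewrite rootE !(hornerD, hornerX, hornerXn) expq2 addrC.
by have := tr0 x; rewrite negbK.
Qed.

(* The Moore determinant: its rows are the conjugates of [x], [y], [z]. *)
Definition moore (x y z : F) : F :=
  (wedge x y) ^+ q * z + ((wedge x y) ^+ q) ^+ q * z ^+ q
  + wedge x y * (z ^+ q) ^+ q.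

(** With the first two arguments fixed, the determinant is the trace of [(wedge x y) ^+ q * z].
    Dividing a [z] of nonzero trace by that nonzero coefficient gives the third argument. *)
Lemma ex_moore_neq0 : exists x y z : F, moore x y z != 0.
Proof.
have [x x_nfix] := ex_not_fixed; have [z tr_z] := ex_trace_neq0.
have w_neq0 : (wedge 1 x) ^+ q != 0.
  by rewrite frob_eq0 /wedge expr1n !mul1r subr_eq0.
exists 1, x, (z / (wedge 1 x) ^+ q); rewrite /moore.
move: (wedge 1 x) w_neq0 => W w_neq0; rewrite !frobE !exprVn frob3.
have W0 : W != 0 by rewrite -frob_eq0.
by rewrite mulrC divfK // ![(W ^+ q) ^+ q * _]mulrC divfK ?frob_eq0 // mulrC divfK.
Qed.

(** * The sets [pi_lam] as subplanes of order [q] *)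

Definition frobv (lam x : F) : vec F := (x, x ^+ q, lam * x ^+ (q ^ 2)).

(** Cramer's rule for the unknowns [a], [b] and [lam * c]: the multipliers of the three equations
    are cofactors of the Moore matrix. *)
Lemma moore_not_orthogonal (lam x y z : F) (w : vec F) : lam != 0 ->
    moore x y z != 0 ->
  dotv F (frobv lam x) w = 0 -> dotv F (frobv lam y) w = 0 ->
  dotv F (frobv lam z) w = 0 -> w = vzero F.
Proof.
move=> lam0 m0; case: w => [[a b] c]; rewrite /dotv /= !expq2 => hx hy hz.
have solve d e : d != 0 -> d * e = 0 -> e = 0 :> F.
  by move=> d0 /eqP; rewrite mulf_eq0 (negPf d0) => /eqP.
move: m0; rewrite /moore wedge_frob2 wedge_frob /wedge; set m := (X in X != 0) => m0.
have a0 : a = 0.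
  apply: (solve m) => //.
  have -> : m * a =
      (y ^+ q * (z ^+ q) ^+ q - (y ^+ q) ^+ q * z ^+ q)
        * (x * a + x ^+ q * b + lam * (x ^+ q) ^+ q * c)
      + (z ^+ q * (x ^+ q) ^+ q - (z ^+ q) ^+ q * x ^+ q)
        * (y * a + y ^+ q * b + lam * (y ^+ q) ^+ q * c)
      + (x ^+ q * (y ^+ q) ^+ q - (x ^+ q) ^+ q * y ^+ q)
        * (z * a + z ^+ q * b + lam * (z ^+ q) ^+ q * c) by rewrite /m; ring.
  by rewrite hx hy hz !mulr0 !addr0.
have b0 : b = 0.
  apply: (solve m) => //.
  have -> : m * b =
      ((y ^+ q) ^+ q * z - y * (z ^+ q) ^+ q)
        * (x * a + x ^+ q * b + lam * (x ^+ q) ^+ q * c)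
      + ((z ^+ q) ^+ q * x - z * (x ^+ q) ^+ q)
        * (y * a + y ^+ q * b + lam * (y ^+ q) ^+ q * c)
      + ((x ^+ q) ^+ q * y - x * (y ^+ q) ^+ q)
        * (z * a + z ^+ q * b + lam * (z ^+ q) ^+ q * c) by rewrite /m; ring.
  by rewrite hx hy hz !mulr0 !addr0.
have c0 : c = 0.
  apply: (solve lam) => //; apply: (solve m) => //.
  have -> : m * (lam * c) =
      (y * z ^+ q - y ^+ q * z)
        * (x * a + x ^+ q * b + lam * (x ^+ q) ^+ q * c)
      + (z * x ^+ q - z ^+ q * x)
        * (y * a + y ^+ q * b + lam * (y ^+ q) ^+ q * c)
      + (x * y ^+ q - x ^+ q * y)
        * (z * a + z ^+ q * b + lam * (z ^+ q) ^+ q * c) by rewrite /m; ring.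
  by rewrite hx hy hz !mulr0 !addr0.
by rewrite a0 b0 c0.
Qed.
Lemma wedgeDl (x y z : F) : wedge (x + y) z = wedge x z + wedge y z.
Proof. by rewrite /wedge !frobE; ring. Qed.

Lemma wedgeZl (c x y : F) : c ^+ q = c -> wedge (c * x) y = c * wedge x y.
Proof. by move=> cE; rewrite /wedge !frobE cE; ring. Qed.

Lemma wedgeC (x y : F) : wedge y x = - wedge x y.
Proof. by rewrite /wedge; ring. Qed.

Lemma wedgexx (x : F) : wedge x x = 0.
Proof. by rewrite /wedge; ring. Qed.

Lemma wedge_neq0l (x y : F) : wedge x y != 0 -> x != 0.
Proof.
have q_gt0 := ltnW q_gt1.
by apply: contraNneq => ->; rewrite /wedge expr0n gtn_eqF // !mul0r subrr.
Qed.

Lemma frobvZ (lam c x : F) : c ^+ q = c ->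
  frobv lam (c * x) = scalev F c (frobv lam x).
Proof.
by move=> cE; rewrite /frobv /scalev /= !frobE !cE; congr (_, _, _); ring.
Qed.

Lemma dot_frobvD (lam x y : F) w :
  dotv F (frobv lam (x + y)) w = dotv F (frobv lam x) w + dotv F (frobv lam y) w.
Proof. by rewrite /dotv /frobv /= !frobE; ring. Qed.

(** Two parameters give the same point exactly when their ratio is fixed by Frobenius; the first two
    coordinates already force this. *)
Lemma eq_pt_frobv (lam x y : F) : x != 0 -> y != 0 ->
  (pt F (frobv lam x) == pt F (frobv lam y)) = (wedge x y == 0).
Proof.
move=> x0 y0; apply/eqP/eqP => [/eq_pt[k k0 [xE x'E _]]|].
  by rewrite /wedge x'E xE; ring.
case/(wedge_eq0 _ _ y0) => c cE xE; rewrite xE frobvZ // pt_scale //.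
by apply: contra_neq x0 => c0; rewrite xE c0 mul0r.
Qed.

Lemma frobv_neq0 (lam x : F) : x != 0 -> frobv lam x != vzero F.
Proof. exact: vec_neq0. Qed.

Lemma pi_lamP (lam : F) P :
  reflect (exists2 x : F, x != 0 & P = pt F (frobv lam x)) (P \in pi_lam F q lam).
Proof.
by apply: (iffP imsetP) => -[x]; rewrite ?inE => x0 ->; exists x; rewrite ?inE.
Qed.

Lemma pi_lam_points lam : pi_lam F q lam \subset points F.
Proof. by apply/subsetP => _ /pi_lamP[x x0 ->]; apply/pt_points/frobv_neq0. Qed.

(** With [W = wedge x y], eliminating [b], then [a], from the two incidence equations expresses
    [W * a] and [W * b] through [c]. Hence [w] is [lam * c / W] times the dual vector with parameter
    [W ^+ q]. *)
Lemma line_frobv (lam x y : F) w : lam != 0 -> wedge x y != 0 -> w != vzero F ->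
    dotv F (frobv lam x) w = 0 -> dotv F (frobv lam y) w = 0 ->
  pt F w = pt F (frobv lam^-1 (wedge x y ^+ q)).
Proof.
move=> lam0 W0; case: w => [[a b] c] w0; rewrite /dotv /= !expq2 => hx hy.
have Wa : wedge x y * a = lam * wedge x y ^+ q * c.
  apply/eqP; rewrite -subr_eq0; apply/eqP.
  transitivity (y ^+ q * (x * a + x ^+ q * b + lam * (x ^+ q) ^+ q * c)
    - x ^+ q * (y * a + y ^+ q * b + lam * (y ^+ q) ^+ q * c)); last first.
    by rewrite hx hy; ring.
  by rewrite wedge_frob /wedge; ring.
have Wb : wedge x y * b = lam * (wedge x y ^+ q) ^+ q * c.
  apply/eqP; rewrite -subr_eq0; apply/eqP.
  transitivity (x * (y * a + y ^+ q * b + lam * (y ^+ q) ^+ q * c)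
     - y * (x * a + x ^+ q * b + lam * (x ^+ q) ^+ q * c)); last first.
    by rewrite hx hy; ring.
  by rewrite wedge_frob2 /wedge; ring.
move: (wedge x y) W0 Wa Wb => W W0 Wa Wb.
have c0 : c != 0.
  apply: contraNneq w0 => c0; move: Wa Wb; rewrite c0 !mulr0.
  move=> /eqP; rewrite mulf_eq0 (negPf W0) => /eqP->.
  by move=> /eqP; rewrite mulf_eq0 (negPf W0) => /eqP->.
have k0 : lam * c / W != 0 by rewrite !mulf_neq0 ?invr_eq0.
rewrite -[RHS](pt_scale _ _ _ k0) /scalev /frobv /= !frobE.
congr (pt F (_, _, _)); apply: (mulfI W0).
- by rewrite Wa; field.
- by rewrite Wb; field.
- by field; rewrite lam0 W0.
Qed.

Lemma secantP (lam : F) L : lam != 0 -> L \in points F ->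
    secant F (pi_lam F q lam) L ->
  exists x y w, [/\ wedge x y != 0, w != vzero F, L = pt F w,
    dotv F (frobv lam x) w = 0 & dotv F (frobv lam y) w = 0].
Proof.
move=> lam0 /pointsP[w w0 ->] /card_gt1P[P [Q []]]; rewrite !inE.
case/andP=> /pi_lamP[x x0 ->] /andP[_]; rewrite incid_pt => /eqP xw.
case/andP=> /pi_lamP[y y0 ->] /andP[_]; rewrite incid_pt => /eqP yw.
by rewrite eq_pt_frobv // => W0; exists x, y, w.
Qed.

Lemma secant_frobv (lam : F) L : lam != 0 -> L \in points F ->
    secant F (pi_lam F q lam) L ->
  exists2 a : F, a != 0 & L = pt F (frobv lam^-1 a).
Proof.
move=> lam0 PL /(secantP _ _ lam0 PL)[x [y [w [W0 w0 -> xw yw]]]].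
by exists (wedge x y ^+ q); rewrite ?frob_eq0 //; apply: line_frobv.
Qed.

(** The secant through the points with parameters [x] and [y] carries the point of [x] and the
    points of [y + c * x], one for each of the [q] elements [c] fixed by Frobenius. *)
Lemma card_secant (lam : F) L : lam != 0 -> L \in points F ->
  secant F (pi_lam F q lam) L -> #|pi_lam F q lam :&: pts_on F L| = (q + 1)%N.
Proof.
move=> lam0 PL /(secantP _ _ lam0 PL)[x [y [w [W0 w0 -> xw yw]]]].
have W0' : wedge y x != 0 by rewrite wedgeC oppr_eq0.
have x0 := wedge_neq0l _ _ W0.
pose f c := pt F (frobv lam (y + c * x)).
have wedgef c : c ^+ q = c -> wedge (y + c * x) x = wedge y x.
  by move=> cE; rewrite wedgeDl wedgeZl // wedgexx mulr0 addr0.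
have f0 c : c ^+ q = c -> y + c * x != 0.
  by move=> cE; apply: (wedge_neq0l _ x); rewrite wedgef.
pose Fq := [set c : F | c ^+ q == c].
have -> : pi_lam F q lam :&: pts_on F (pt F w) = pt F (frobv lam x) |: f @: Fq.
  apply/setP => P; rewrite in_setI in_setU1 [P \in pts_on _ _]in_set; apply/idP/orP.
    case/andP=> /pi_lamP[z z0 ->] /andP[_]; rewrite incid_pt => /eqP zw.
    have [Wzx|Wzx] := eqVneq (wedge z x) 0.
      by left; rewrite eq_pt_frobv // Wzx.
    (* Both [z] and [y] span this line with [x], so [wedge z x] is [d] times [wedge y x] with [d]
       fixed by Frobenius. Then [z - d * y] is a fixed multiple [e] of [x], and
       [z = d * (y + (e / d) * x)]. *)
    right; have := line_frobv _ _ _ _ lam0 Wzx w0 zw xw.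
    rewrite (line_frobv _ _ _ _ lam0 W0' w0 yw xw) => /esym/eqP.
    rewrite eq_pt_frobv ?frob_eq0 // => /eqP/wedge_eq0 [|d dE]; first by rewrite frob_eq0.
    rewrite -{1}dE -exprMn => /frob_inj zx.
    have d0 : d != 0 by apply: contraNneq Wzx => d0; rewrite zx d0 mul0r.
    have : wedge (z + (- d) * y) x = 0.
      by rewrite wedgeDl wedgeZl ?frobN ?dE // zx; ring.
    case/(wedge_eq0 _ _ x0) => e eE zE.
    apply/imsetP; exists (e / d); first by rewrite inE exprMn exprVn eE dE.
    rewrite /f -[RHS](pt_scale _ _ _ d0) -frobvZ //; congr (pt F (frobv lam _)).
    by rewrite mulrDr mulrA [d * (e / d)]mulrC divfK // -zE; ring.
  case=> [/eqP->|/imsetP[c]].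
    rewrite incid_pt xw eqxx pt_points ?frobv_neq0 // !andbT.
    by apply/pi_lamP; exists x.
  rewrite inE => /eqP cE ->.
  rewrite incid_pt dot_frobvD yw frobvZ // dotvZl xw mulr0 addr0 eqxx.
  rewrite pt_points ?frobv_neq0 ?f0 // !andbT.
  by apply/pi_lamP; exists (y + c * x); rewrite ?f0.
rewrite cardsU1 card_in_imset => [|c d].
  suff -> : pt F (frobv lam x) \notin f @: Fq by rewrite card_fixed_frob addnC.
  apply/imsetP => -[c]; rewrite inE => /eqP cE /eqP.
  by rewrite eq_sym eq_pt_frobv ?f0 // wedgef // (negPf W0').
rewrite !inE => /eqP cE /eqP dE /eqP; rewrite eq_pt_frobv ?f0 //.
have -> : wedge (y + c * x) (y + d * x) = (d - c) * wedge y x.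
  by rewrite /wedge !frobE cE dE; ring.
by rewrite mulf_eq0 (negPf W0') orbF subr_eq0 => /eqP.
Qed.

(** Dually to [line_frobv], the lines with parameters [a] and [b] meet at the point given by their
    cross product, whose parameter is [wedge a b ^+ q]. *)
Lemma secants_meet (lam : F) L M : lam != 0 -> L \in points F -> M \in points F ->
    secant F (pi_lam F q lam) L -> secant F (pi_lam F q lam) M -> L != M ->
  exists2 P, P \in pi_lam F q lam & incid F P L && incid F P M.
Proof.
move=> lam0 PL PM /(secant_frobv _ _ lam0 PL)[a a0 ->].
case/(secant_frobv _ _ lam0 PM)=> b b0 ->; rewrite eq_pt_frobv // => W0.
exists (pt F (frobv lam (wedge a b ^+ q))).
  by apply/pi_lamP; exists (wedge a b ^+ q); rewrite ?frob_eq0.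
rewrite !incid_pt /dotv /frobv /= !expq2 frob3 wedge_frob2 wedge_frob /wedge.
by apply/andP; split; apply/eqP; field.
Qed.

Lemma moore_not_collinear (lam x y z : F) : lam != 0 -> moore x y z != 0 ->
  ~~ collinear F (pt F (frobv lam x)) (pt F (frobv lam y)) (pt F (frobv lam z)).
Proof.
move=> lam0 m0; apply/collinearP => -[l l0 [xl yl zl]].
by rewrite (moore_not_orthogonal _ _ _ _ _ lam0 m0 xl yl zl) eqxx in l0.
Qed.

Lemma mooreE (x y z : F) :
  moore x y z = (x ^+ q * (y ^+ q) ^+ q - (x ^+ q) ^+ q * y ^+ q) * z
    + ((x ^+ q) ^+ q * y - x * (y ^+ q) ^+ q) * z ^+ q
    + (x * y ^+ q - x ^+ q * y) * (z ^+ q) ^+ q.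
Proof. by rewrite /moore wedge_frob2 wedge_frob. Qed.

Lemma moore_neq0 (x y z : F) : moore x y z != 0 -> z != 0.
Proof.
have q_gt0 := ltnW q_gt1; have F0 : (0 : F) ^+ q = 0 by rewrite expr0n gtn_eqF.
by apply: contraNneq => ->; rewrite /moore !F0 !mulr0 !addr0.
Qed.

Lemma pi_lam_plane (lam : F) : lam != 0 -> Fq_plane F q (pi_lam F q lam).
Proof.
move=> lam0; apply/and4P; split; first exact: pi_lam_points.
- apply/forallP => L; apply/implyP => PL; apply/implyP => sL.
  by rewrite card_secant.
- apply/forallP => L; apply/implyP => PL; apply/forallP => M; apply/implyP => PM.
  apply/implyP=> /and3P[sL sM LM].
  have [P PS PLM] := secants_meet _ _ _ lam0 PL PM sL sM LM.
  by apply/existsP; exists P; rewrite PS.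
(* The quadrangle is a basis together with the sum of its vectors: each of the four Moore
   determinants is that of the basis up to sign. *)
have [x [y [z m0]]] := ex_moore_neq0; set t := x + y + z.
have mxyt : moore x y t = moore x y z by rewrite /t !mooreE !frobE; ring.
have mxzt : moore x z t = - moore x y z by rewrite /t !mooreE !frobE; ring.
have myzt : moore y z t = moore x y z by rewrite /t !mooreE !frobE; ring.
have mxzy : moore x z y = - moore x y z by rewrite !mooreE; ring.
have myzx : moore y z x = moore x y z by rewrite !mooreE; ring.
have x0 : x != 0 by apply: (moore_neq0 y z); rewrite myzx.
have y0 : y != 0 by apply: (moore_neq0 x z); rewrite mxzy oppr_eq0.
have z0 : z != 0 := moore_neq0 _ _ _ m0.
have t0 : t != 0 by apply: (moore_neq0 x y); rewrite mxyt.
have mem u : u != 0 -> pt F (frobv lam u) \in pi_lam F q lam.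
  by move=> u0; apply/pi_lamP; exists u.
apply/existsP; exists (pt F (frobv lam x)); rewrite mem //=.
apply/existsP; exists (pt F (frobv lam y)); rewrite mem //=.
apply/existsP; exists (pt F (frobv lam z)); rewrite mem //=.
apply/existsP; exists (pt F (frobv lam t)); rewrite mem //=.
by apply/and4P; split; apply: moore_not_collinear; rewrite ?mxyt ?mxzt ?myzt ?oppr_eq0.
Qed.

(** * The action of [phi] and of [S_T] on points and on the sets [pi_lam] *)

Lemma phivZ k (v : vec F) : phiv F q (scalev F k v) = scalev F (k ^+ q) (phiv F q v).
Proof. by rewrite /phiv /scalev /= !exprMn. Qed.

Lemma phiP_pt (v : vec F) : phiP F q (pt F v) = pt F (phiv F q v).
Proof.
apply/setP => u; apply/imsetP/ptP => [[_ /ptP[k k0 ->] ->]|[k k0 ->]].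
  by exists (k ^+ q); rewrite ?frob_eq0 ?phivZ.
exists (scalev F ((k ^+ q) ^+ q) v); last by rewrite phivZ frob3.
by apply/ptP; exists ((k ^+ q) ^+ q); rewrite ?frob_eq0.
Qed.

Lemma phiv_inj : injective (phiv F q).
Proof.
by move=> [[x y] z] [[x' y'] z'] [/frob_inj-> /frob_inj-> /frob_inj->].
Qed.

Lemma psiP_pt (t : F) (v : vec F) : psiP F q t (pt F v) = pt F (psiv F q t v).
Proof.
have psivZ k w : psiv F q t (scalev F k w) = scalev F k (psiv F q t w).
  by rewrite /psiv /scalev /=; congr (_, _, _); ring.
apply/setP => u; apply/imsetP/ptP => [[_ /ptP[k k0 ->] ->]|[k k0 ->]].
  by exists k.
by exists (scalev F k v); rewrite ?psivZ //; apply/ptP; exists k.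
Qed.

Lemma psiv_frobv (lam t s : F) : psiv F q t (frobv lam s) = frobv lam (t * s).
Proof. by rewrite /psiv /frobv /= !exprMn; congr (_, _, _); ring. Qed.

Lemma ST_orbit_frobv (lam s : F) : s != 0 ->
  ST_orbit F q (pt F (frobv lam s)) = pi_lam F q lam.
Proof.
move=> s0; apply/setP => P; apply/imsetP/pi_lamP => [[t]|[x x0 ->]].
  by rewrite inE => t0 ->; exists (t * s); rewrite ?mulf_neq0 // psiP_pt psiv_frobv.
exists (x / s); first by rewrite inE mulf_neq0 ?invr_eq0.
by rewrite psiP_pt psiv_frobv divfK.
Qed.

Lemma pi_lam_orb (lam : F) : pi_lam F q lam \in orb_ST F q.
Proof.
apply/imsetP; exists (pt F (frobv lam 1)); last by rewrite ST_orbit_frobv ?oner_eq0.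
by rewrite pt_points ?frobv_neq0 ?oner_eq0.
Qed.

(** If the point [(1, 1, lam)] lies in the second set, its parameter there is fixed by Frobenius,
    and the third coordinates then agree. *)
Lemma pi_lam_inj : injective (pi_lam F q).
Proof.
move=> lam mu eq_pi; have : pt F (frobv lam 1) \in pi_lam F q mu.
  by rewrite -eq_pi; apply/pi_lamP; exists 1; rewrite ?oner_eq0.
case/pi_lamP=> x x0 /eq_pt[k k0 []]; rewrite !frobE mulr1 => kx kx' ->.
have xE : x ^+ q = x by apply: (mulfI k0); rewrite -kx'.
by rewrite !xE mulrCA -kx mulr1.
Qed.

(** Since [lam ^+ 2] has norm [lam ^+ 6 = 1], Hilbert 90 gives [s] with [s ^+ q = lam ^+ 2 * s];
    [phi] sends parameter [x] to [s * x], up to the scalar [lam / s]. Injectivity of [phi] turns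
    this inclusion into equality. *)
Lemma phiS_pi_lam (lam : F) : lam ^+ q = lam -> lam ^+ 3 = 1 ->
  phiS F q (pi_lam F q lam) = pi_lam F q lam.
Proof.
move=> lamq lam3; apply/eqP.
rewrite eqEcard [X in (_ <= X)%N]card_imset ?leqnn ?andbT; last first.
  exact: (imset_inj phiv_inj).
have lam0 := cube_root_neq0 _ _ lam3.
have [|s s0 sE] := hilbert90 (lam ^+ 2).
  by rewrite /frob_norm !(exprAC lam 2 q, lamq) -[RHS](expr1n _ 2) -lam3; ring.
apply/subsetP => _ /imsetP[_ /pi_lamP[x x0 ->] ->].
apply/pi_lamP; exists (s * x); first exact: mulf_neq0.
have k0 : lam / s != 0 by rewrite mulf_neq0 ?invr_eq0.
rewrite phiP_pt -[RHS](pt_scale _ _ _ k0) /phiv /scalev /frobv /= !frobE lamq -!sE.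
rewrite !frobE !lamq -!sE; congr (pt F (_, _, _)).
- by field.
- by rewrite -[LHS]mul1r -lam3; field.
- by rewrite -[LHS]mul1r -(expr1n _ 2) -lam3; field.
Qed.

(** * Orbits of [S_T] invariant under [phi] *)

(** As [mu ^+ 3 = 1], the power [mu ^+ q] depends only on [q] modulo 3; each residue is treated
    separately. *)
Lemma cube_root_fixed (mu a : F) :
  mu ^+ 3 = 1 -> mu ^+ q = a * mu -> a ^+ q = a -> a = 1.
Proof.
move=> mu3 muq aq.
have mu0 := cube_root_neq0 _ _ mu3.
have muqE : mu ^+ q = mu ^+ (q %% 3) by rewrite (expr_mod q mu3).
have : (q %% 3 < 3)%N by rewrite ltn_mod.
move: muq; rewrite muqE; case E : (q %% 3)%N => [|[|[|//]]] muq _.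
- have aE : a = mu^-1 by apply: (mulIf mu0); rewrite -muq mulVf.
  by rewrite -aq aE exprVn muqE E invr1.
- by apply: (mulIf mu0); rewrite -muq mul1r.
- have aE : a = mu by apply: (mulIf mu0); rewrite -muq.
  by move: aq; rewrite aE muqE E expr2 -{3}[mu]mulr1 => /(mulfI mu0).
Qed.

Lemma frob_normM (x y : F) : frob_norm (x * y) = frob_norm x * frob_norm y.
Proof. by rewrite /frob_norm !frobE; ring. Qed.

Lemma frob_norm_frob (x : F) : frob_norm (x ^+ q) = frob_norm x.
Proof. by rewrite /frob_norm frob3; ring. Qed.

Lemma frob_norm_fixed (x : F) : frob_norm x ^+ q = frob_norm x.
Proof. by rewrite /frob_norm !frobE; ring. Qed.

Lemma frob_norm_eq0 (x : F) : (frob_norm x == 0) = (x == 0).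
Proof. by rewrite /frob_norm !mulf_eq0 !frob_eq0 !orbb. Qed.

Lemma phi_fixed_frobv (x y z k t : F) : x != 0 -> y != 0 -> z != 0 -> k != 0 -> t != 0 ->
    phiv F q (x, y, z) = scalev F k (psiv F q t (x, y, z)) ->
  exists lam s : F, [/\ s != 0, lam ^+ q = lam, lam ^+ 3 = 1 &
    pt F (x, y, z) = pt F (frobv lam s)].
Proof.
move=> x0 y0 z0 k0 t0 []; rewrite /= expq2 => zE xE yE.
(* Both quantities are unchanged by scalars and by [S_T]; on [frobv lam s] they equal [lam] and
   1. *)
pose mu := z * x ^+ q / (y * y ^+ q); pose a := frob_norm y / frob_norm x.
have Nx0 : frob_norm x != 0 by rewrite frob_norm_eq0.
have aq : a ^+ q = a by rewrite exprMn exprVn !frob_norm_fixed.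
have muq : mu ^+ q = a * mu.
  (* Eliminating [k] and [t] from the three coordinate equations gives, after division,
     [mu = a * (mu ^+ q) ^+ q]; one more Frobenius yields the claim. *)
  have : z * (x ^+ q) ^+ 2 * (x ^+ q) ^+ q = y * (y ^+ q) ^+ 2 * (z ^+ q) ^+ q.
    have x2E : (x ^+ q) ^+ q = k ^+ q * (t ^+ q) ^+ q * y ^+ q by rewrite xE !frobE; ring.
    have z2E : (z ^+ q) ^+ q = k ^+ q * t ^+ q * x ^+ q by rewrite zE !frobE; ring.
    transitivity (z * x ^+ q * (k * (t ^+ q * y)) * (k ^+ q * (t ^+ q) ^+ q * y ^+ q)).
      by rewrite -xE -x2E; ring.
    transitivity (y * y ^+ q * (k * ((t ^+ q) ^+ q * z)) * (k ^+ q * t ^+ q * x ^+ q)).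
      by ring.
    by rewrite -yE -z2E; ring.
  have muq2E : mu = a * (mu ^+ q) ^+ q -> mu ^+ q = a * mu.
    by move=> {1}->; rewrite exprMn frob3 aq.
  move=> H; apply: muq2E; rewrite /mu /a /frob_norm !(exprMn, exprVn) !frob3.
  have [x'0 y'0] : x ^+ q != 0 /\ y ^+ q != 0 by rewrite !frob_eq0.
  have [x''0 y''0] : (x ^+ q) ^+ q != 0 /\ (y ^+ q) ^+ q != 0 by rewrite !frob_eq0.
  have x20 : x ^+ q * (x ^+ q) ^+ q != 0 by rewrite mulf_neq0.
  transitivity (y ^+ q * (z ^+ q) ^+ q / (x ^+ q * (x ^+ q) ^+ q)).
    apply/eqP; rewrite eqr_div // ?mulf_neq0 //; apply/eqP.
    transitivity (z * (x ^+ q) ^+ 2 * (x ^+ q) ^+ q); first by ring.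
    by rewrite H; ring.
  by field; rewrite x0 x'0 x''0 y0 y''0.
(* Taking norms, [N(x)/N(y)] and [N(y)/N(z)] are both [N(k) N(t)], so [N(z) N(x) = N(y)^2]. *)
have Nmu : frob_norm mu = 1.
  have Nx : frob_norm x = frob_norm k * frob_norm t * frob_norm y.
    by rewrite -frob_norm_frob xE !frob_normM frob_norm_frob mulrA.
  have Ny : frob_norm y = frob_norm k * frob_norm t * frob_norm z.
    by rewrite -frob_norm_frob yE !frob_normM !frob_norm_frob mulrA.
  have : frob_norm (z * x ^+ q) = frob_norm (y * y ^+ q).
    by rewrite !frob_normM !frob_norm_frob {1}Nx {2}Ny; ring.
  have -> : z * x ^+ q = mu * (y * y ^+ q) by rewrite divfK // mulf_neq0 ?frob_eq0.
  rewrite frob_normM => /eqP; rewrite -subr_eq0 -{2}[frob_norm (y * _)]mul1r -mulrBl.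
  rewrite mulf_eq0 frob_norm_eq0 mulf_eq0 frob_eq0 (negPf y0) !orbF subr_eq0.
  by move/eqP.
have a3 : a ^+ 3 = 1.
  have : frob_norm (mu ^+ q) = 1 by rewrite frob_norm_frob.
  by rewrite muq frob_normM Nmu mulr1 /frob_norm !aq => <-; ring.
(* The conjugates of [mu] are [a * mu] and [a ^+ 2 * mu], so its norm is [a ^+ 3 * mu ^+ 3]. *)
have mu3 : mu ^+ 3 = 1.
  move: muq aq a3 Nmu; move: mu a => m b mq bq b3; rewrite /frob_norm mq exprMn mq bq.
  by move=> <-; rewrite -[LHS]mul1r -b3; ring.
have a1 : a = 1 := cube_root_fixed mu a mu3 muq aq.
(* The norm of [y / x] is [a = 1]. The resulting [s] satisfies [s ^+ q / s = y / x], which matches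
   the first two coordinates up to [x / s]. *)
have [|s s0 sE] := hilbert90 (y / x).
  rewrite -[LHS]/(frob_norm _); apply: (mulIf Nx0).
  by rewrite -frob_normM divfK // mul1r -[LHS](divfK Nx0) -/a a1 mul1r.
exists mu, s; split; rewrite ?muq ?a1 ?mul1r //.
have xs0 : x / s != 0 by rewrite mulf_neq0 ?invr_eq0.
rewrite -[RHS](pt_scale _ _ _ xs0) /scalev /frobv /= !frobE -!sE !frobE -!sE.
rewrite exprVn /mu; congr (pt F (_, _, _)).
- by rewrite divfK.
- by field; rewrite x0 s0.
- by field; rewrite !frob_eq0 x0 s0 y0.
Qed.

(** * Type III points of [pi_lam] *)

(** Differences of the equations give [a = b = c], leaving [(lam + 2) * a = 0]. *)
Lemma circulant_eq0 (lam a b c : F) : lam ^+ 3 = 1 -> lam != 1 ->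
    a + b + lam * c = 0 -> lam * a + b + c = 0 -> a + lam * b + c = 0 ->
  [/\ a = 0, b = 0 & c = 0].
Proof.
move=> lam3 lam1 h1 h2 h3.
have lamB1 : lam - 1 != 0 by rewrite subr_eq0.
have cE : c = a.
  apply: (mulfI lamB1); apply/eqP; rewrite -subr_eq0; apply/eqP.
  transitivity ((a + b + lam * c) - (lam * a + b + c)); first by ring.
  by rewrite h1 h2 subrr.
have bE : b = a.
  apply: (mulfI lamB1); apply/eqP; rewrite -subr_eq0; apply/eqP.
  transitivity ((a + lam * b + c) - (lam * a + b + c)); first by ring.
  by rewrite h3 h2 subrr.
(* In characteristic 3 the only cube root of unity is 1. *)
have three0 : 3%:R != 0 :> F.
  apply: contraNneq lamB1 => three0; suff: (lam - 1) ^+ 3 == 0 by rewrite expf_eq0.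
  have -> : (lam - 1) ^+ 3 = lam ^+ 3 - 1 - 3%:R * (lam ^+ 2 - lam) by ring.
  by rewrite lam3 three0 mul0r subrr subr0.
(* If [lam = -2], then [lam ^+ 3 = 1] reads [9 = 0]. *)
have lam2 : lam + 2%:R != 0.
  apply: contraNneq three0 => lam2; suff: 3%:R ^+ 2 == 0 :> F by rewrite expf_eq0.
  have -> : 3%:R ^+ 2 =
      (lam + 2%:R) * (lam ^+ 2 - 2%:R * lam + 4%:R) - (lam ^+ 3 - 1) :> F.
    by ring.
  by rewrite lam2 lam3 mul0r !subrr.
have a0 : a = 0.
  by apply: (mulfI lam2); rewrite mulr0 -[RHS]h2 bE cE; ring.
by rewrite bE cE a0.
Qed.

(** Applying [phi] moves the factor [lam] cyclically through the coordinates, so a common line gives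
    a circulant system in [x * a], [x ^+ q * b] and [(x ^+ q) ^+ q * c]. *)
Lemma frobv_orbit_not_collinear (lam x : F) :
    lam ^+ q = lam -> lam ^+ 3 = 1 -> lam != 1 -> x != 0 ->
  let P := pt F (frobv lam x) in ~~ collinear F P (phiP F q P) (phiP F q (phiP F q P)).
Proof.
move=> lamq lam3 lam1 x0 /=; rewrite !phiP_pt.
apply/collinearP => -[[[a b] c] l0 []].
rewrite /dotv /phiv /frobv /= !frobE !lamq => h1 h2 h3.
have [] := circulant_eq0 lam (x * a) (x ^+ q * b) ((x ^+ q) ^+ q * c) lam3 lam1.
- by rewrite mulrA.
- by rewrite mulrA.
- by rewrite mulrA.
move=> /eqP; rewrite mulf_eq0 (negPf x0) => /eqP a0.
move=> /eqP; rewrite mulf_eq0 frob_eq0 (negPf x0) => /eqP b0.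
move=> /eqP; rewrite mulf_eq0 !frob_eq0 (negPf x0) => /eqP c0.
by rewrite a0 b0 c0 eqxx in l0.
Qed.

(** * Fixed points of [phi], and the list of fixed planes *)

(** For a fixed point with scalar [k], three applications of [phi] give [N(k) = 1]; Hilbert 90 for
    [k^-1] rescales the vector to the required form. *)
Lemma pi_1_P2q : pi_lam F q 1 = P2q F q.
Proof.
apply/setP => P; apply/pi_lamP/idP => [[x x0 ->]|].
  rewrite inE pt_points ?frobv_neq0 // phiP_pt /=; apply/eqP.
  by rewrite /phiv /frobv /= !frobE !mul1r.
rewrite in_set => /andP[/pointsP[[[x y] z] v0 ->]].
rewrite phiP_pt => /eqP/eq_pt[k k0 []] zx xy yz.
have x0 : x != 0.
  apply: contraNneq v0 => x0; move: zx; rewrite x0 mulr0 => /eqP.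
  rewrite frob_eq0 => /eqP z0; move: yz; rewrite z0 mulr0 => /eqP.
  by rewrite frob_eq0 => /eqP->.
have Nk : k * k ^+ q * (k ^+ q) ^+ q = 1.
  apply: (mulIf x0); rewrite mul1r -[RHS]frob3 xy !frobE yz !frobE zx; ring.
have [|s s0 sE] := hilbert90 k^-1.
  by rewrite /frob_norm !exprVn -!invfM Nk invr1.
exists (s * x); first exact: mulf_neq0.
rewrite -(pt_scale _ s) // /scalev /frobv /= !frobE mul1r -!sE xy !frobE -!sE yz.
rewrite !exprVn; congr (pt F (_, _, _)).
- by field.
- by field; rewrite frob_eq0 k0.
Qed.

(** If 3 divides [q - 1], all three cube roots of unity are fixed by Frobenius; otherwise [q] is 0
    or 2 modulo 3, and a fixed cube root is 1. *)
Lemma card_lam : #|[set lam : F | (lam ^+ q == lam) && (lam ^+ 3 == 1)]| = gcdn 3 (q - 1).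
Proof.
rewrite subn1.
have [dvd3|ndvd3] := boolP (3 %| q.-1)%N.
  rewrite (gcdn_idPl dvd3) -[RHS](card_unity_roots F 3); last first.
    by rewrite cardF_pred dvdn_mull.
  apply: eq_card => lam; rewrite !inE andb_idl // => /eqP lam3.
  by case/dvdnP: dvd3 => m qE; rewrite fixed_frobE qE mulnC exprM lam3 expr1n eqxx orbT.
have /eqP-> : coprime 3 q.-1 by rewrite prime_coprime.
rewrite -[RHS](cards1 (1 : F)); apply: eq_card => lam; rewrite !inE.
apply/andP/eqP => [[/eqP lamq /eqP lam3]|->]; last by rewrite !expr1n.
have lam0 := cube_root_neq0 _ _ lam3.
move: lamq; rewrite -(expr_mod q lam3).
have : (q %% 3 < 3)%N by rewrite ltn_mod.
case E : (q %% 3)%N => [|[|[|//]]] _.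
- by rewrite expr0 => <-.
- by case/negP: ndvd3; rewrite -subn1 -eqn_mod_dvd ?E // ltnW ?q_gt1.
- by rewrite expr2 -{3}[lam]mulr1 => /(mulfI lam0).
Qed.


Lemma fixed_planesE : fixed_planes F q =
  pi_lam F q @: [set lam : F | (lam ^+ q == lam) && (lam ^+ 3 == 1)].
Proof.
apply/setP => X; rewrite [LHS]in_set; apply/idP/imsetP; last first.
  case=> lam; rewrite inE => /andP[/eqP lamq /eqP lam3] ->.
  have lam0 := cube_root_neq0 _ _ lam3.
  by rewrite pi_lam_orb pi_lam_plane // phiS_pi_lam //=.
case/and3P=> /imsetP[_ /pointsP[[[x y] z] v0 ->] ->] plane_X /eqP phi_X.
have memX t : t != 0 -> pt F (psiv F q t (x, y, z)) \in ST_orbit F q (pt F (x, y, z)).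
  by move=> t0; rewrite -psiP_pt; apply/imsetP; exists t; rewrite ?inE.
(* The maps [psi_t] scale each coordinate, so a zero coordinate of the base point would put the
   whole orbit on a coordinate line. *)
have coord_neq0 (l : vec F) : l != vzero F ->
    exists2 t, t != 0 & dotv F (psiv F q t (x, y, z)) l != 0.
  move=> /(plane_not_on_line _ _ _ _ plane_X)[P /imsetP[t]]; rewrite inE => t0 ->.
  by rewrite psiP_pt incid_pt; exists t.
have x0 : x != 0.
  have [|t _] := coord_neq0 (1, 0, 0); first by rewrite vec_neq0 ?oner_eq0.
  by apply: contraNneq => x0; rewrite /dotv /= x0 !mulr0 mul0r !addr0.
have y0 : y != 0.
  have [|t _] := coord_neq0 (0, 1, 0); first by rewrite !xpair_eqE oner_eq0 andbF.
  by apply: contraNneq => y0; rewrite /dotv /= y0 !mulr0 mul0r !addr0.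
have z0 : z != 0.
  have [|t _] := coord_neq0 (0, 0, 1); first by rewrite !xpair_eqE oner_eq0 andbF.
  by apply: contraNneq => z0; rewrite /dotv /= z0 !mulr0 mul0r !addr0.
have : phiP F q (pt F (x, y, z)) \in ST_orbit F q (pt F (x, y, z)).
  rewrite -phi_X; apply: imset_f.
  by have := memX 1 (oner_neq0 F); rewrite /psiv /= !expr1n !mul1r.
rewrite phiP_pt => /imsetP[t]; rewrite inE psiP_pt => t0 /eq_pt[k k0 phiE].
have [lam [s [s0 lamq lam3 vE]]] := phi_fixed_frobv x y z k t x0 y0 z0 k0 t0 phiE.
by exists lam; rewrite ?inE ?lamq ?lam3 ?eqxx // vE ST_orbit_frobv.
Qed.
End CubicFrobenius.

Theorem theorem3p2 (F : finFieldType) (q : nat)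
  (hq : exists2 p : nat, prime p & exists k : nat, q = (p ^ k.+1)%N)
  (hF : #|F| = (q ^ 3)%N) :
  [/\ #|fixed_planes F q| = gcdn 3 (q - 1),
      fixed_planes F q =
        pi_lam F q @: [set lam : F | (lam ^+ q == lam) && (lam ^+ 3 == 1)],
      pi_lam F q 1 = P2q F q &
      (gcdn 3 (q - 1) = 3%N ->
       forall lam : F, lam ^+ q = lam -> lam ^+ 3 = 1 -> lam != 1 ->
         (forall P, P \in pi_lam F q lam -> typeIII_pt F q P) /\
         (forall L, L \in points F ->
            #|pi_lam F q lam :&: pts_on F L| = (q + 1)%N -> typeIII_line F q L))].
Proof.
split.
- rewrite fixed_planesE // card_imset; last exact: pi_lam_inj.
  exact: card_lam.
- exact: fixed_planesE.
- exact: pi_1_P2q.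
move=> _ lam lamq lam3 lam1.
have lam0 := cube_root_neq0 _ _ lam3.
split=> [_ /pi_lamP[x x0 ->]|L PL cardL]; first exact: frobv_orbit_not_collinear.
(* Having [q + 1] points is at least having two. *)
have sL : secant F (pi_lam F q lam) L.
  by rewrite /secant cardL addn1 ltnS ltnW ?(q_gt1 q hq).
have [a a0 ->] := secant_frobv F q hq hF lam L lam0 PL sL.
(* The line has the coordinates of a point of the set for [lam^-1], again a nontrivial cube root of
   unity fixed by Frobenius, so the result on points applies. *)
rewrite /typeIII_line !phiP_pt // concurrent_collinear -!phiP_pt //.
apply: frobv_orbit_not_collinear => //.
- by rewrite exprVn lamq.
- by rewrite exprVn lam3 invr1.
- by rewrite invr_eq1.
Qed.
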